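(* Let $m\ge1$ and let $t_1(z_2),\dots,t_m(z_2)$ be pairwise distinct holomorphic functions of $z_2$. Put $$x_1(z_1,z_2)=\sum_{k=1}^m\frac1{z_1-t_k(z_2)},\qquad x_m(z_1,z_2)=\frac1{\prod_{\ell=1}^m(z_1-t_\ell(z_2))},$$ and suppose that the $z_2$-evolution is the $g_1$-flow, i.e. with $z_1$ held fixed, $$\frac{\partial x_1}{\partial z_2}=x_1x_m .$$ Then in the pole coordinates $(t_1,\dots,t_m)$ the $g_1$-flow induces the ODE system $$\frac{dt_j}{dz_2}=\frac1{\prod_{k\ne j}(t_j-t_k)},\qquad j=1,\dots,m .$$ This system is singular exactly on the discriminant $$\Delta=\Bigl\{(t_1,\dots,t_m)\in\mathbb{C}^m:\ \prod_{i<j}(t_i-t_j)^2=0\Bigr\}.$$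
   Context: The variables $z_1,z_2$ are complex times; $t_1,\dots,t_m$ are the locations of the poles in $z_1$ of $x_1(\cdot,z_2)$, called pole coordinates. The component $g_1=x_1x_m$ is the first component of the vector field $G=(x_1x_m,\dots,x_{m-1}x_m,x_m^2)$, and in the $g_1$-flow $x_1$ and $x_m$ are understood as the displayed expressions in the $t_k$, as functions of $z_1$ away from the poles; the equation $\partial x_1/\partial z_2=x_1x_m$ is required for all $z_1\notin\{t_1(z_2),\dots,t_m(z_2)\}$. ''Singular exactly on $\Delta$'' means that the right-hand sides of the ODE system, as functions of $(t_1,\dots,t_m)\in\mathbb{C}^m$, are all regular off $\Delta$, and at every point of $\Delta$ at least one of them blows up (its denominator vanishes). Empty products equal $1$ (so for $m=1$ the set $\Delta$ is empty). *)

(* Defs.v *)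
From HB Require Import structures.
From mathcomp Require Import all_boot all_order all_algebra complex.
From mathcomp Require Import all_classical all_reals all_analysis.
Import Order.TTheory GRing.Theory Num.Theory.
Import numFieldNormedType.Exports.

Set Implicit Arguments.
Unset Strict Implicit.
Unset Printing Implicit Defensive.

Local Open Scope classical_set_scope.
Local Open Scope ring_scope.

(* Typing [R[i]] as a [numClosedFieldType] is what makes the topology and the
   normed-module structure of a number field available on it.  The derivatives
   below are therefore complex derivatives. *)
Definition Cplx (R : realType) : numClosedFieldType := R[i].

Section PoleCoordinates.
Variables (R : realType) (m : nat).
Local Notation C := (Cplx R).

Definition holomorphic_on (U : set C) (f : C -> C) : Prop :=
  forall z, U z -> derivable f z 1.

Section Flow.
Variable t : 'I_m -> C -> C.

(* The inverse of 0 is 0, so [x_first] and [x_last] have their intended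
   meaning only when z1 is not one of the t_k(z2). *)
Definition x_first (z1 z2 : C) : C := \sum_(k < m) 1 / (z1 - t k z2).

Definition x_last (z1 z2 : C) : C := 1 / \prod_(l < m) (z1 - t l z2).

Definition g1 (z1 z2 : C) : C := x_first z1 z2 * x_last z1 z2.

Definition g1_flow_on (U : set C) : Prop :=
  forall z1 z2 : C, U z2 -> (forall k, z1 != t k z2) ->
    is_derive z2 1 (fun w : C => x_first z1 w) (g1 z1 z2).

End Flow.

Definition pole_denom (j : 'I_m) (s : 'rV[C]_m) : C :=
  \prod_(k < m | k != j) (s 0 j - s 0 k).

Definition pole_rhs (j : 'I_m) (s : 'rV[C]_m) : C := 1 / pole_denom j s.

Definition discriminant_locus : set 'rV[C]_m :=
  [set s | \prod_(i < m) \prod_(j < m | (i < j)%N) (s 0 i - s 0 j) ^+ 2 = 0].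

(* Holomorphy near [s]: Frechet differentiability over C on a neighbourhood. *)
Definition regular_at (j : 'I_m) (s : 'rV[C]_m) : Prop :=
  pole_denom j s != 0 /\ \forall u \near s, differentiable (pole_rhs j) u.

(* The quotient is a genuine one only where its denominator does not vanish, so
   the limit is taken within that set; the closure condition keeps it from
   being vacuous. *)
Definition blows_up_at (j : 'I_m) (s : 'rV[C]_m) : Prop :=
  let D := [set u | pole_denom j u != 0] in
  [/\ pole_denom j s = 0,
      closure D s &
      `|pole_rhs j u| @[u --> within D (nbhs s)] --> +oo].

End PoleCoordinates.

(* Main.v *)
Require Import Defs.
From HB Require Import structures.
From mathcomp Require Import all_boot all_order all_algebra complex.
From mathcomp Require Import all_classical all_reals all_analysis.
Import Order.TTheory GRing.Theory Num.Theory.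
Import numFieldNormedType.Exports.
Local Open Scope classical_set_scope.
Local Open Scope ring_scope.

(** The equations of the flow compare rational functions of z1.

    Differentiating x_first with z1 fixed gives the sum of the
    t_k' / (z1 - t_k)^2, so the g1-flow says that this sum equals
    x_first * x_last for all z1 off the poles.  Both sides have at most double
    poles at the t_j.  On the left the coefficient of (z1 - t_j)^-2 is t_j'; on
    the right only the term 1 / (z1 - t_j) of x_first can produce it, and the
    other factor x_last contributes 1 / \prod_(k != j) (t_j - t_k).  Lemma
    [double_pole_coef] carries out this comparison: multiplied by the square of
    \prod_l (z1 - t_l), the equation becomes an identity of polynomials, which
    holds off a finite set, hence everywhere, and is evaluated at t_j.

    For the singularities, the discriminant vanishes exactly when one of the
    denominators does ([discriminant_locusP]).  Where a denominator is nonzero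
    it stays so nearby, and the inverse of a polynomial map is differentiable
    there.  Where it vanishes, continuity makes it tend to 0, so the modulus of
    its inverse tends to infinity ([cvgy_norm_inv]); points with a nonzero
    denominator accumulate there because moving the single coordinate s_j by a
    small amount avoids the finitely many other coordinates
    ([closure_pole_denom_neq0]). *)

(** * Equating the double poles of a rational function *)

(** Multiplying p - q by a polynomial that vanishes on s gives a polynomial
    that vanishes everywhere, hence is 0 because a numFieldType is infinite. *)
Lemma poly_eq_off_seq (K : numFieldType) (p q : {poly K}) (s : seq K) :
  (forall z, z \notin s -> p.[z] = q.[z]) -> p = q.
Proof.
move=> pq; apply/eqP; rewrite -subr_eq0.
pose r := (p - q) * \prod_(a <- s) ('X - a%:P).
have r0 : r = 0.
  apply/eqP/negPn/negP => rN0.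
  (* The natural numbers embed in K and provide more roots than the degree. *)
  pose rs := [seq (i%:R : K) | i <- iota 0 (size r)].
  have := @max_poly_roots _ _ rs rN0.
  rewrite size_map size_iota ltnn => /(_ _ _)/negP; apply=> //; last first.
    rewrite map_inj_uniq ?iota_uniq // => i j /eqP.
    by rewrite eqr_nat => /eqP.
  apply/allP => z _; rewrite rootM root_prod_XsubC orbC.
  by case: (boolP (z \in s)) => //= /pq pqz; rewrite rootE hornerD hornerN pqz subrr.
move/eqP: r0; rewrite mulf_eq0 => /orP[//|].
by rewrite (negbTE (monic_neq0 (monic_prod_XsubC _ _ _))).
Qed.

(** The coefficient at (z - t_j)^-2 is read off on both sides of a partial
    fraction identity; only the k = j summands contribute to it. *)
Lemma double_pole_coef (K : numFieldType) (m : nat) (t d : 'I_m -> K) :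
  injective t ->
  (forall z, (forall k, z != t k) ->
     \sum_(k < m) d k / (z - t k) ^+ 2 =
     (\sum_(k < m) 1 / (z - t k)) * (1 / \prod_(l < m) (z - t l))) ->
  forall j, d j = 1 / \prod_(k < m | k != j) (t j - t k).
Proof.
move=> tinj flow j.
(* [co k] is \prod_l ('X - t_l) divided by 'X - t_k. *)
pose co (k : 'I_m) : {poly K} := \prod_(l < m | l != k) ('X - (t l)%:P).
have coE k z : (co k).[z] = \prod_(l < m | l != k) (z - t l).
  by rewrite horner_prod; apply: eq_bigr => l _; rewrite hornerXsubC.
(* The hypothesis multiplied by (\prod_l (z - t_l))^2. *)
have pq : \sum_(k < m) d k *: co k ^+ 2 = \sum_(k < m) co k.
  apply: (@poly_eq_off_seq _ _ _ [seq t k | k <- enum 'I_m]) => z zs.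
  have zt k : z - t k != 0.
    rewrite subr_eq0; apply: contra zs => /eqP ->.
    by apply: map_f; rewrite mem_enum.
  have Pk k : \prod_(l < m) (z - t l) = (z - t k) * (co k).[z].
    by rewrite coE (bigD1 k).
  have P0 : \prod_(l < m) (z - t l) != 0 by apply/prodf_neq0.
  rewrite !horner_sum.
  have /flow : forall k, z != t k by move=> k; rewrite -subr_eq0.
  move/(congr1 (fun w => w * (\prod_(l < m) (z - t l)) ^+ 2)).
  rewrite mul1r [in RHS]expr2 [in RHS]mulrA mulfVK // !mulr_suml => flowz.
  under eq_bigr => k _ do rewrite hornerZ horner_exp.
  transitivity (\sum_(k < m)
      d k / (z - t k) ^+ 2 * (\prod_(l < m) (z - t l)) ^+ 2).
    by apply: eq_bigr => k _; rewrite (Pk k) exprMn [RHS]mulrA divfK ?expf_neq0.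
  rewrite flowz; apply: eq_bigr => k _.
  by rewrite (Pk k) mul1r mulKf.
have co0 k : k != j -> (co k).[t j] = 0.
  by move=> kj; rewrite coE (bigD1 j) 1?eq_sym //= subrr mul0r.
have coj : (co j).[t j] != 0.
  rewrite coE; apply/prodf_neq0 => k kj; rewrite subr_eq0.
  by apply: contra kj => /eqP/tinj ->.
have dj : d j * (co j).[t j] ^+ 2 = (co j).[t j].
  move/(congr1 (horner^~ (t j))): pq; rewrite !horner_sum.
  rewrite (bigD1 j) //= [in RHS](bigD1 j) //= !big1 ?addr0.
  - by rewrite hornerZ horner_exp.
  - by move=> k kj; rewrite co0.
  - by move=> k kj; rewrite hornerZ horner_exp co0 // expr0n mulr0.
by rewrite -coE -[LHS](mulfK (expf_neq0 2 coj)) dj expr2 invfM mulrA divff.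
Qed.

(** * The flow of the simple poles *)

Lemma is_derive_sum_inv_sub (K : numFieldType) (m : nat) (t : 'I_m -> K -> K)
    (z w : K) :
  (forall k, z != t k w) -> (forall k, derivable (t k) w 1) ->
  is_derive w 1 (fun v : K => \sum_(k < m) 1 / (z - t k v))
    (\sum_(k < m) 'D_1 (t k) w / (z - t k w) ^+ 2).
Proof.
move=> zt td.
rewrite (_ : (fun _ => _) = \sum_(k < m) (fun v => (z - t k v)^-1)); last first.
  by apply/funext => v; rewrite fct_sumE; apply: eq_bigr => k _; rewrite div1r.
apply: is_derive_sum => k.
have subd : is_derive w 1 (fun v => z - t k v) (- 'D_1 (t k) w).
  have := is_deriveB (is_derive_cst z w 1) (derivableP (td k)).
  by rewrite sub0r; exact.
have sub0 : z - t k w != 0 by rewrite subr_eq0.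
have [subv subD] := subd.
apply: DeriveDef; first exact: derivableV.
rewrite deriveV // subD scalerN scaleNr opprK.
exact: mulrC.
Qed.

(** * Singularities of the right-hand sides *)

Lemma differentiable_prod (K : numFieldType) (V : normedModType K) (I : Type)
    (r : seq I) (P : pred I) (F : I -> V -> K) (x : V) :
  (forall i, P i -> differentiable (F i) x) ->
  differentiable (fun y => \prod_(i <- r | P i) F i y) x.
Proof.
move=> dF; elim: r => [|i r IH].
  rewrite (_ : (fun _ => _) = cst 1); first exact: differentiable_cst.
  by apply/funext => y; rewrite big_nil.
case Pi: (P i); last first.
  rewrite (_ : (fun _ => _) = (fun y => \prod_(k <- r | P k) F k y)) //.
  by apply/funext => y; rewrite big_cons Pi.
rewrite (_ : (fun _ => _) = F i * (fun y => \prod_(k <- r | P k) F k y)).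
  by apply: differentiableM => //; exact: dF.
by apply/funext => y; rewrite big_cons Pi.
Qed.

Lemma differentiable_pole_denom (R : realType) (m : nat) (j : 'I_m)
    (s : 'rV[Cplx R]_m) : differentiable (@pole_denom R m j) s.
Proof.
apply: differentiable_prod => k _.
by apply: differentiableB; exact: differentiable_coord.
Qed.

Lemma continuous_pole_denom (R : realType) (m : nat) (j : 'I_m) :
  continuous (@pole_denom R m j).
Proof.
by move=> s; apply/differentiable_continuous/differentiable_pole_denom.
Qed.

(** The denominators vanish when two coordinates agree, whichever comes first,
    whereas the discriminant lists each pair once. *)
Lemma discriminant_locusP (R : realType) (m : nat) (s : 'rV[Cplx R]_m) :
  discriminant_locus s <-> exists j, pole_denom j s = 0.
Proof.
split.
  move/eqP/prodf_eq0 => [i _ /prodf_eq0[j ij]].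
  rewrite expf_eq0 /= => sij; exists i; apply/eqP/prodf_eq0.
  by exists j => //; rewrite -val_eqE gtn_eqF.
case=> i /eqP/prodf_eq0[j ji sij].
wlog ij : i j ji sij / (i < j)%N.
  move=> W; case: (ltngtP i j) => [|lji|/val_inj eij].
  - exact: (W i j).
  - apply: (W j i) lji; first by rewrite eq_sym.
    by rewrite -opprB oppr_eq0.
  - by rewrite eij eqxx in ji.
apply/eqP/prodf_eq0; exists i => //; apply/prodf_eq0; exists j => //.
by rewrite expf_eq0.
Qed.

(** The order of K may be partial, as for complex numbers, so the bound M in a
    neighbourhood of infinity is replaced by the positive `|M| + 1. *)
Lemma cvgy_norm_inv (K : numFieldType) (T : Type) (F : set_system T)
    {FF : Filter F} (f : T -> K) :
  f x @[x --> F] --> 0 -> (\forall x \near F, f x != 0) ->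
  `|1 / f x| @[x --> F] --> +oo.
Proof.
move=> f0 fN0 A [M [Mreal MA]].
have M1 : 0 < `|M| + 1 by apply: ltr_wpDl.
have : \forall x \near F, `|f x| < (`|M| + 1)^-1.
  by move/cvgr0Pnorm_lt: f0; apply; rewrite invr_gt0.
apply: filterS2 fN0 => x fx0 fxM; apply: MA.
rewrite div1r normfV; apply: (@le_lt_trans _ _ `|M|); first exact: real_ler_norm.
apply: (@lt_trans _ _ (`|M| + 1)); first by rewrite ltrDl.
by rewrite -[ltLHS]invrK ltf_pV2 // posrE ?invr_gt0 ?normr_gt0.
Qed.

Lemma near_dnbhs_neq (K : numFieldType) (a b : K) :
  \forall e \near a^', e != b.
Proof.
have [->|ab] := eqVneq b a; first exact: withinT.
apply: nbhs_dnbhs.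
have : \forall e \near a, e - b != 0.
  have cab : e - b @[e --> a] --> a - b.
    by apply: (cvgB cvg_id); exact: cvg_cst.
  by apply: (cvgr_neq0 _ cab); rewrite subr_eq0 eq_sym.
by apply: filterS => e; rewrite subr_eq0.
Qed.

(** Along the line s + e *: delta_mx 0 j the denominator is the product of the
    s_j - s_k + e, which vanishes for finitely many values of e only. *)
Lemma closure_pole_denom_neq0 (R : realType) (m : nat) (j : 'I_m)
    (s : 'rV[Cplx R]_m) : closure [set u | pole_denom j u != 0] s.
Proof.
move=> B Bs.
pose u (e : Cplx R) : 'rV[Cplx R]_m := s + e *: delta_mx 0 j.
have us : u e @[e --> 0^'] --> s.
  rewrite -[X in _ --> X]addr0 -(scale0r (delta_mx 0 j : 'rV[Cplx R]_m)).
  apply: cvgD; first exact: cvg_cst.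
  apply: cvgZr_tmp.
  exact: nbhs_dnbhs.
have uB : \forall e \near (0 : Cplx R)^', B (u e) by exact: us.
have uD : \forall e \near (0 : Cplx R)^', forall k : 'I_m, e != s 0 k - s 0 j.
  by apply: filter_forall => k; exact: near_dnbhs_neq.
have [e [Be De]] := filter_ex (filterI uB uD).
exists (u e); split => //; apply/prodf_neq0 => k kj.
rewrite !mxE !eqxx (negbTE kj) mulr1 mulr0 addr0 subr_eq0.
by apply: contra (De k) => /eqP <-; rewrite addrAC subrr add0r.
Qed.

Theorem proposition4p4 (R : realType) (m : nat) (hm : (1 <= m)%N) :
  (forall (U : set (Cplx R)) (t : 'I_m -> Cplx R -> Cplx R),
     open U ->
     (forall k, holomorphic_on U (t k)) ->
     (forall z2, U z2 -> forall i j, i != j -> t i z2 != t j z2) ->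
     g1_flow_on t U ->
     forall z2, U z2 -> forall j : 'I_m,
       is_derive z2 1 (t j) (pole_rhs j (\row_k t k z2))) /\
  (forall s : 'rV[Cplx R]_m,
     ~ discriminant_locus s -> forall j : 'I_m, regular_at j s) /\
  (forall s : 'rV[Cplx R]_m,
     discriminant_locus s -> exists j : 'I_m, blows_up_at j s).
Proof.
split; [|split].
- move=> U t _ thol tneq flow z2 Uz2 j.
  have tinj : injective (t^~ z2).
    by move=> i k /eqP; apply: contraTeq => /(tneq _ Uz2).
  have td k : derivable (t k) z2 1 by exact: thol.
  apply: DeriveDef => //.
  rewrite (double_pole_coef _ _ _ (fun k => 'D_1 (t k) z2) tinj).
    by rewrite /pole_rhs /pole_denom; under [in RHS]eq_bigr do rewrite !mxE.
  move=> z zt.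
  (* Both are the derivative of x_first at z2, with z fixed. *)
  have xd := is_derive_sum_inv_sub _ _ _ _ _ zt td.
  have fd := flow z z2 Uz2 zt.
  by rewrite -(@derive_val _ _ _ _ _ _ _ xd) -/(x_first t z _) (@derive_val _ _ _ _ _ _ _ fd).
- move=> s sD j.
  have s0 : pole_denom j s != 0.
    by apply/eqP => js0; apply: sD; apply/discriminant_locusP; exists j.
  split=> //; apply: filterS (cvgr_neq0 _ (@continuous_pole_denom R m j s) s0) => u u0.
  rewrite (_ : pole_rhs j = fun v => (pole_denom j v)^-1); last first.
    by apply/funext => v; rewrite /pole_rhs div1r.
  by apply: differentiableV => //; exact: differentiable_pole_denom.
- move=> s /discriminant_locusP[j sj]; exists j; split => //.
    exact: closure_pole_denom_neq0.
  apply: cvgy_norm_inv; last exact: withinT.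
  apply: cvg_within_filter.
  by have := @continuous_pole_denom R m j s; rewrite /continuous_at sj.
Qed.
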